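(* For every set $X$, the collection $\mathcal F(X)$, ordered by inclusion and with the overlap relation $A\bowtie B\iff(\exists x\in X)(x\in A\cap B)$, is an o-Heyting algebra. In general $\mathcal F(X)$ is neither a Boolean algebra (i.e. constructively it is not the case that one can show that $\mathcal F(X)$ is a Boolean algebra for every set $X$) nor an o-algebra (i.e. it is not the case that $\mathcal F(X)$ is an o-algebra for every set $X$).
   Context: The result is constructive (intuitionistic logic, no excluded middle). A subset $K\subseteq X$ is finite if either $K=\emptyset$ or $K=\{x_1,\dots,x_n\}$ for some $x_1,\dots,x_n\in X$. For $A\subseteq X$, $-A=\{x\in X\mid \neg(x\in A)\}$. $\mathcal F(X)$ is the sub-family of the collection $\mathcal P(X)$ of all subsets of $X$ defined by: $A\in\mathcal F(X)$ iff there is a finite $K\subseteq X$ such that $A\subseteq --K$ or $-K\subseteq A$. An overlap lattice with opposite (oo-lattice) is a quadruple $(\mathcal P,\le,\bowtie,-)$ where $(\mathcal P,\le)$ is a bounded lattice (with bottom $0$ and top $1$), $-$ is a pseudo-complement operation ($p\wedge q=0\iff p\le -q$) and $\bowtie$ is a binary relation on $\mathcal P$ such that for all $p,q$: (symmetry) $p\bowtie q\Rightarrow q\bowtie p$; (meet closure) $p\bowtie q\Rightarrow p\bowtie(p\wedge q)$; (splitting of existing joins) whenever $(q_i)_{i\in I}$ is a set-indexed family whose join $\bigvee_{i\in I}q_i$ exists, $p\bowtie\bigvee_{i\in I}q_i\iff(\exists i\in I)(p\bowtie q_i)$; (density) $(\forall r\in\mathcal P)(r\bowtie p\Rightarrow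 r\bowtie q)\Rightarrow p\le q$. All oo-lattices are assumed set-based: there is a set $S$ of elements (a base) such that for every $p$ the join of $\{a\in S\mid a\le p\}$ exists and equals $p$. An o-Heyting algebra is an oo-lattice whose underlying lattice is a Heyting algebra. An o-algebra is a (set-based) structure $(\mathcal P,\le,\bowtie)$ in which $\le$ has joins of all set-indexed families and $\bowtie$ satisfies symmetry, meet closure, splitting of all set-indexed joins, and density; in particular it is complete. *)

(* Defs.v *)
From Stdlib Require Import List Ensembles.
Set Implicit Arguments.
Unset Strict Implicit.

(** * Ordered structures with an overlap relation

    Sets are types in [Set], collections are arbitrary types.  Since [X -> Prop]
    is not in [Set], the powerset of a set is a collection that cannot index its
    own joins, so that having a base is a genuine condition.

    No quotients and no extensionality axioms are used: an order is a preorder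
    and equality of the ordered collection is [equiv], mutual inequality.  For
    subsets ordered by inclusion this is the usual extensional equality. *)

Section Order.
Variables (P : Type) (le : P -> P -> Prop).

Definition equiv (p q : P) : Prop := le p q /\ le q p.

Record is_order : Prop := {
  order_refl : forall p, le p p;
  order_trans : forall p q r, le p q -> le q r -> le p r }.

Definition is_meet (p q m : P) : Prop :=
  forall r, le r m <-> le r p /\ le r q.

Definition is_join (p q j : P) : Prop :=
  forall r, le j r <-> le p r /\ le q r.

Definition is_family_join (I : Set) (q : I -> P) (j : P) : Prop :=
  forall r, le j r <-> forall i, le (q i) r.

Record is_bounded_lattice (meet join : P -> P -> P) (bot top : P) : Prop := {
  lattice_order : is_order;
  lattice_meet : forall p q, is_meet p q (meet p q);
  lattice_join : forall p q, is_join p q (join p q);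
  lattice_bot : forall p, le bot p;
  lattice_top : forall p, le p top }.

Definition set_based : Prop :=
  exists (S : Set) (b : S -> P), forall p,
    is_family_join (fun a : {a : S | le (b a) p} => b (proj1_sig a)) p.

(** [overlap_join] is splitting of existing joins, which in a complete order is
    splitting of all set-indexed joins.  Binary meets are given by a universal
    property; they exist in a lattice, and in a set-based complete order. *)
Record is_overlap (ov : P -> P -> Prop) : Prop := {
  overlap_sym : forall p q, ov p q -> ov q p;
  overlap_meet : forall p q m, is_meet p q m -> ov p q -> ov p m;
  overlap_join : forall p (I : Set) (q : I -> P) (j : P),
    is_family_join q j -> (ov p j <-> exists i, ov p (q i));
  overlap_density : forall p q, (forall r, ov r p -> ov r q) -> le p q }.

Record is_oo_lattice (ov : P -> P -> Prop) (meet join : P -> P -> P)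
    (bot top : P) (opp : P -> P) : Prop := {
  oo_lattice_bounded : is_bounded_lattice meet join bot top;
  oo_lattice_pseudo_complement :
    forall p q, equiv (meet p q) bot <-> le p (opp q);
  oo_lattice_overlap : is_overlap ov;
  oo_lattice_set_based : set_based }.

Definition is_o_Heyting_algebra (ov : P -> P -> Prop) : Prop :=
  exists (meet join imp : P -> P -> P) (bot top : P) (opp : P -> P),
    is_oo_lattice ov meet join bot top opp /\
    forall p q r, le (meet p q) r <-> le p (imp q r).

Definition is_Boolean_algebra : Prop :=
  exists (meet join : P -> P -> P) (bot top : P) (compl : P -> P),
    is_bounded_lattice meet join bot top /\
    (forall p q r, equiv (meet p (join q r)) (join (meet p q) (meet p r))) /\
    forall p, equiv (meet p (compl p)) bot /\ equiv (join p (compl p)) top.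

Record is_o_algebra (ov : P -> P -> Prop) : Prop := {
  o_algebra_order : is_order;
  o_algebra_joins : forall (I : Set) (q : I -> P), exists j, is_family_join q j;
  o_algebra_overlap : is_overlap ov;
  o_algebra_set_based : set_based }.

End Order.

(** * The collection [F X] *)

(** Not [Stdlib.Sets.Finite_sets.Finite], which enumerates without repetition and
    hence is stronger unless equality on [X] is decidable. *)
Definition finite (X : Type) (K : Ensemble X) : Prop :=
  exists l : list X, forall x, Ensembles.In X K x <-> List.In x l.

Definition in_F (X : Type) (A : Ensemble X) : Prop :=
  exists K : Ensemble X, finite K /\
    (Included X A (Complement X (Complement X K)) \/
     Included X (Complement X K) A).

Definition F (X : Set) : Type := {A : Ensemble X | in_F A}.

Definition F_le (X : Set) (A B : F X) : Prop :=
  Included X (proj1_sig A) (proj1_sig B).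

Definition F_overlap (X : Set) (A B : F X) : Prop :=
  exists x, Ensembles.In X (Intersection X (proj1_sig A) (proj1_sig B)) x.

(** * Intuitionistic higher-order logic

    What can be shown constructively is a matter of provability.  The formal
    system is intuitionistic higher-order logic over an arbitrary set [base], with
    power sets, products and natural numbers; it has full comprehension and
    extensionality, but neither choice nor excluded middle.

    Formulas are many-sorted, with typed de Bruijn indices.  Variables are the only
    terms (pairing, zero and successor are given by their graphs), so substitution
    is renaming.  Derivations keep track of the variables in scope: [base] is not
    assumed to be inhabited. *)

Inductive sort : Set :=
| base
| num
| prd (s t : sort)
| pow (s : sort).

Inductive var : list sort -> sort -> Set :=
| vz G s : var (s :: G) s
| vs G s t (x : var G s) : var (t :: G) s.
Arguments vz {G s}.
Arguments vs {G s t} x.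

(** [Pair x y z] says z = (x, y), and [Succ n m] says m = n + 1. *)
Inductive fm : list sort -> Set :=
| Mem G s (x : var G s) (A : var G (pow s)) : fm G
| Pair G s t (x : var G s) (y : var G t) (z : var G (prd s t)) : fm G
| Zero G (n : var G num) : fm G
| Succ G (n m : var G num) : fm G
| Bot G : fm G
| And G (p q : fm G) : fm G
| Or G (p q : fm G) : fm G
| Imp G (p q : fm G) : fm G
| All G s (p : fm (s :: G)) : fm G
| Ex G s (p : fm (s :: G)) : fm G.
Arguments Bot {G}.
Arguments All {G} s p.
Arguments Ex {G} s p.

Definition ren (G D : list sort) : Set := forall s, var G s -> var D s.

Definition ren_id (G : list sort) : ren G G := fun _ y => y.
Definition ren_shift (G : list sort) (s : sort) : ren G (s :: G) :=
  fun _ y => vs y.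

Definition ren_cons (G D : list sort) (s : sort) (x : var D s) (r : ren G D) :
    ren (s :: G) D :=
  fun t v =>
    match v in var E t'
      return match E with
             | nil => unit
             | s' :: G' => var D s' -> ren G' D -> var D t'
             end
    with
    | vz => fun x _ => x
    | vs y => fun _ r => r _ y
    end x r.

Definition up (G D : list sort) (s : sort) (r : ren G D) :
    ren (s :: G) (s :: D) :=
  ren_cons vz (fun t y => vs (r t y)).

Fixpoint rename (G : list sort) (p : fm G) : forall D, ren G D -> fm D :=
  match p in fm G return forall D, ren G D -> fm D with
  | Mem x A => fun D r => Mem (r _ x) (r _ A)
  | Pair x y z => fun D r => Pair (r _ x) (r _ y) (r _ z)
  | Zero n => fun D r => Zero (r _ n)
  | Succ n m => fun D r => Succ (r _ n) (r _ m)
  | Bot => fun D r => Bot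
  | And p q => fun D r => And (rename p r) (rename q r)
  | Or p q => fun D r => Or (rename p r) (rename q r)
  | Imp p q => fun D r => Imp (rename p r) (rename q r)
  | All s p => fun D r => All s (rename p (up r))
  | Ex s p => fun D r => Ex s (rename p (up r))
  end.

Definition weaken (G : list sort) (s : sort) (p : fm G) : fm (s :: G) :=
  rename p (@ren_shift G s).

Definition inst (G : list sort) (s : sort) (p : fm (s :: G)) (x : var G s) :
    fm G :=
  rename p (ren_cons x (@ren_id G)).

Definition Neg (G : list sort) (p : fm G) : fm G := Imp p Bot.
Definition Iff (G : list sort) (p q : fm G) : fm G := And (Imp p q) (Imp q p).

Declare Scope fm_scope.
Delimit Scope fm_scope with fm.
Bind Scope fm_scope with fm.
Infix "∧" := And (at level 80, right associativity) : fm_scope.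
Infix "∨" := Or (at level 85, right associativity) : fm_scope.
Infix "⇒" := Imp (at level 90, right associativity) : fm_scope.
Infix "⇔" := Iff (at level 95, no associativity) : fm_scope.
Notation "¬ p" := (Neg p) (at level 75, right associativity) : fm_scope.
Local Open Scope fm_scope.

Local Notation v0 := vz.
Local Notation v1 := (vs v0).
Local Notation v2 := (vs v1).
Local Notation v3 := (vs v2).
Local Notation v4 := (vs v3).
Local Notation v5 := (vs v4).
Local Notation v6 := (vs v5).

(** Leibniz equality. *)
Definition Eq (G : list sort) (s : sort) (x y : var G s) : fm G :=
  All (pow s) (Mem (vs x) v0 ⇒ Mem (vs y) v0).

Inductive axiom (G : list sort) : fm G -> Prop :=
| ax_comprehension s (p : fm (s :: G)) :
    axiom (Ex (pow s) (All s (Mem v0 v1 ⇔ rename p (up (@ren_shift G (pow s))))))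
| ax_extensionality s :
    axiom (All (pow s) (All (pow s)
      (All s (Mem v0 v2 ⇔ Mem v0 v1) ⇒ Eq v1 v0)))
| ax_pair_total s t :
    axiom (All s (All t (Ex (prd s t) (Pair v2 v1 v0))))
| ax_pair_unique s t :
    axiom (All s (All t (All (prd s t) (All (prd s t)
      (Pair v3 v2 v1 ⇒ Pair v3 v2 v0 ⇒ Eq v1 v0)))))
| ax_pair_surjective s t :
    axiom (All (prd s t) (Ex s (Ex t (Pair v1 v0 v2))))
| ax_pair_injective s t :
    axiom (All s (All t (All s (All t (All (prd s t)
      (Pair v4 v3 v0 ⇒ Pair v2 v1 v0 ⇒ Eq v4 v2 ∧ Eq v3 v1))))))
| ax_zero_exists :
    axiom (Ex num (Zero v0))
| ax_zero_unique :
    axiom (All num (All num (Zero v1 ⇒ Zero v0 ⇒ Eq v1 v0)))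
| ax_succ_total :
    axiom (All num (Ex num (Succ v1 v0)))
| ax_succ_unique :
    axiom (All num (All num (All num (Succ v2 v1 ⇒ Succ v2 v0 ⇒ Eq v1 v0))))
| ax_succ_injective :
    axiom (All num (All num (All num (Succ v2 v0 ⇒ Succ v1 v0 ⇒ Eq v2 v1))))
| ax_succ_not_zero :
    axiom (All num (All num (Succ v1 v0 ⇒ ¬ Zero v0)))
| ax_induction :
    axiom (All (pow num)
      (All num (Zero v0 ⇒ Mem v0 v1) ⇒
       All num (All num (Mem v1 v2 ⇒ Succ v1 v0 ⇒ Mem v0 v2)) ⇒
       All num (Mem v0 v1))).

Inductive derivable : forall G, list (fm G) -> fm G -> Prop :=
| d_axiom G (H : list (fm G)) p : axiom p -> derivable H p
| d_hyp G (H : list (fm G)) p : List.In p H -> derivable H p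
| d_Bot_elim G (H : list (fm G)) p : derivable H Bot -> derivable H p
| d_And_intro G (H : list (fm G)) p q :
    derivable H p -> derivable H q -> derivable H (p ∧ q)
| d_And_elim_l G (H : list (fm G)) p q : derivable H (p ∧ q) -> derivable H p
| d_And_elim_r G (H : list (fm G)) p q : derivable H (p ∧ q) -> derivable H q
| d_Or_intro_l G (H : list (fm G)) p q : derivable H p -> derivable H (p ∨ q)
| d_Or_intro_r G (H : list (fm G)) p q : derivable H q -> derivable H (p ∨ q)
| d_Or_elim G (H : list (fm G)) p q r :
    derivable H (p ∨ q) -> derivable (p :: H) r -> derivable (q :: H) r ->
    derivable H r
| d_Imp_intro G (H : list (fm G)) p q :
    derivable (p :: H) q -> derivable H (p ⇒ q)
| d_Imp_elim G (H : list (fm G)) p q :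
    derivable H (p ⇒ q) -> derivable H p -> derivable H q
| d_All_intro G (H : list (fm G)) s (p : fm (s :: G)) :
    derivable (map (@weaken G s) H) p -> derivable H (All s p)
| d_All_elim G (H : list (fm G)) s (p : fm (s :: G)) (x : var G s) :
    derivable H (All s p) -> derivable H (inst p x)
| d_Ex_intro G (H : list (fm G)) s (p : fm (s :: G)) (x : var G s) :
    derivable H (inst p x) -> derivable H (Ex s p)
| d_Ex_elim G (H : list (fm G)) s (p : fm (s :: G)) (q : fm G) :
    derivable H (Ex s p) -> derivable (p :: map (@weaken G s) H) (weaken s q) ->
    derivable H q.

(** ** The formula saying that [F base] is a Boolean algebra *)

Definition Le (G : list sort) (A B : var G (pow base)) : fm G :=
  All base (Mem v0 (vs A) ⇒ Mem v0 (vs B)).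

(** The sets of the form ∅ or {x1, ..., xn} are those generated from ∅ by adding
    one element at a time. *)
Definition Finite (G : list sort) (K : var G (pow base)) : fm G :=
  All (pow (pow base))
    (All (pow base) (All base (¬ Mem v0 v1) ⇒ Mem v0 v1) ⇒
     All (pow base) (All base (All (pow base)
       (Mem v2 v3 ⇒ All base (Mem v0 v1 ⇔ Mem v0 v3 ∨ Eq v0 v2) ⇒
        Mem v0 v3))) ⇒
     Mem (vs K) v0).

Definition In_F (G : list sort) (A : var G (pow base)) : fm G :=
  Ex (pow base) (Finite v0 ∧
    (All base (Mem v0 (vs (vs A)) ⇒ ¬ ¬ Mem v0 v1) ∨
     All base (¬ Mem v0 v1 ⇒ Mem v0 (vs (vs A))))).

Definition AllF (G : list sort) (p : fm (pow base :: G)) : fm G :=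
  All (pow base) (In_F v0 ⇒ p).

Definition ExF (G : list sort) (p : fm (pow base :: G)) : fm G :=
  Ex (pow base) (In_F v0 ∧ p).

Definition Is_meet (G : list sort) (A B M : var G (pow base)) : fm G :=
  AllF (Le v0 (vs M) ⇔ Le v0 (vs A) ∧ Le v0 (vs B)).

Definition Is_join (G : list sort) (A B J : var G (pow base)) : fm G :=
  AllF (Le (vs J) v0 ⇔ Le (vs A) v0 ∧ Le (vs B) v0).

Definition Is_bot (G : list sort) (A : var G (pow base)) : fm G :=
  AllF (Le (vs A) v0).

Definition Is_top (G : list sort) (A : var G (pow base)) : fm G :=
  AllF (Le v0 (vs A)).

(** If J = B ∨ C, M = A ∧ B and N = A ∧ C, then A ∧ J is the join of M and N;
    here A, B, C, J, M, N, L are v6, ..., v0. *)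
Definition Distributive : fm nil :=
  AllF (AllF (AllF (AllF (AllF (AllF (AllF
    (Is_join v5 v4 v3 ⇒ Is_meet v6 v5 v2 ⇒ Is_meet v6 v4 v1 ⇒
     Is_meet v6 v3 v0 ⇒ Is_join v2 v1 v0))))))).

Definition Complemented : fm nil :=
  AllF (ExF
    (AllF (Is_meet v2 v1 v0 ⇒ Is_bot v0) ∧ AllF (Is_join v2 v1 v0 ⇒ Is_top v0))).

Definition Boolean_algebra_F : fm nil :=
  ExF (Is_bot v0) ∧ ExF (Is_top v0) ∧
  AllF (AllF (ExF (Is_meet v2 v1 v0))) ∧
  AllF (AllF (ExF (Is_join v2 v1 v0))) ∧
  Distributive ∧ Complemented.

(* Main.v *)
(** Meets, joins and implications of [F X] are the pointwise ones, and singletons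
    form a base.  An existing join j of a family (q_i) with union U is U: for
    x ∈ j the set U ∪ -{x} is in [F X] and contains every q_i, hence j, hence x,
    so that x ∈ U.

    Every subset of a one-point set is in [F], so if that lattice is Boolean then
    excluded middle holds.  For underivability this argument is run in a Kripke
    model of higher-order logic with worlds false < true, where [base] is one point
    and the subset in which that point lies from the world true onwards has no
    complement.

    [F nat] is not complete: the join of the singletons {2n} would be the set of
    even numbers, which is neither bounded nor cobounded. *)

From Stdlib Require Import List Ensembles Arith Lia.
Require Import Defs.

Set Implicit Arguments.
Unset Strict Implicit.

(** * The lattice [F X] *)

Section F_Heyting.
Variable X : Set.

Definition mem (A : F X) (x : X) : Prop := Ensembles.In X (proj1_sig A) x.

(** A list replaces the finite set, so that closure under the operations reduces to choosing or
    concatenating lists. *)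
Lemma in_F_list (A : Ensemble X) :
  in_F A <-> exists l : list X,
    (forall x, Ensembles.In X A x -> ~ ~ List.In x l) \/
    (forall x, ~ List.In x l -> Ensembles.In X A x).
Proof.
  split.
  - intros [K [[l Hl] H]]. exists l. destruct H as [H | H]; [left | right].
    + intros x Ax Hx. apply (H x Ax). intros Kx. apply Hx, Hl, Kx.
    + intros x Hx. apply H. intros Kx. apply Hx, Hl, Kx.
  - intros [l H]. exists (fun x => List.In x l). split.
    + exists l. intros x. reflexivity.
    + exact H.
Qed.

Lemma in_F_singleton (x : X) : in_F (fun y => y = x).
Proof.
  apply in_F_list. exists (x :: nil). left. intros y -> H. apply H. now left.
Qed.

Lemma in_F_and (A B : Ensemble X) : in_F A -> in_F B -> in_F (fun x => A x /\ B x).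
Proof.
  rewrite !in_F_list. intros [k [HA | HA]] [l HB].
  - exists k. left. intros x [Ax _]. now apply HA.
  - destruct HB as [HB | HB].
    + exists l. left. intros x [_ Bx]. now apply HB.
    + exists (k ++ l). right. intros x Hx.
      split; [apply HA | apply HB]; intros H; apply Hx, in_or_app; auto.
Qed.

Lemma in_F_or (A B : Ensemble X) : in_F A -> in_F B -> in_F (fun x => A x \/ B x).
Proof.
  rewrite !in_F_list. intros [k [HA | HA]] [l HB].
  - destruct HB as [HB | HB].
    + exists (k ++ l). left. intros x [Ax | Bx] Hx.
      * apply (HA x Ax). intros H. apply Hx, in_or_app. auto.
      * apply (HB x Bx). intros H. apply Hx, in_or_app. auto.
    + exists l. right. intros x Hx. right. now apply HB.
  - exists k. right. intros x Hx. left. now apply HA.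
Qed.

(** If [A] is bounded by [k], the implication is vacuous off [k]; if [B] is cobounded, so is the
    implication. If [A] is cobounded and [B] bounded, then off [k ++ l] the set [A] holds and [B]
    fails, so the implication is bounded by [k ++ l]. *)
Lemma in_F_imp (A B : Ensemble X) : in_F A -> in_F B -> in_F (fun x => A x -> B x).
Proof.
  rewrite !in_F_list. intros [k [HA | HA]] [l HB].
  - exists k. right. intros x Hx Ax. destruct (HA x Ax Hx).
  - destruct HB as [HB | HB].
    + exists (k ++ l). left. intros x ABx Hx.
      apply (HB x).
      * apply ABx, HA. intros H. apply Hx, in_or_app. auto.
      * intros H. apply Hx, in_or_app. auto.
    + exists l. right. intros x Hx _. now apply HB.
Qed.

Lemma in_F_False : in_F (fun _ : X => False).
Proof. apply in_F_list. exists nil. left. intros x []. Qed.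

Lemma in_F_True : in_F (fun _ : X => True).
Proof. apply in_F_list. exists nil. right. intros x _. exact I. Qed.

Definition F_singleton (x : X) : F X := exist _ _ (in_F_singleton x).
Definition F_meet (A B : F X) : F X :=
  exist _ _ (in_F_and (proj2_sig A) (proj2_sig B)).
Definition F_join (A B : F X) : F X :=
  exist _ _ (in_F_or (proj2_sig A) (proj2_sig B)).
Definition F_imp (A B : F X) : F X :=
  exist _ _ (in_F_imp (proj2_sig A) (proj2_sig B)).
Definition F_bot : F X := exist _ _ in_F_False.
Definition F_top : F X := exist _ _ in_F_True.

Lemma F_singleton_le (x : X) (A : F X) : F_le (F_singleton x) A <-> mem A x.
Proof.
  split.
  - intros H. now apply H.
  - intros Ax y ->. exact Ax.
Qed.

Lemma F_overlap_mem (A B : F X) : F_overlap A B <-> exists x, mem A x /\ mem B x.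
Proof.
  split.
  - intros [x [x' Ax Bx]]. now exists x'.
  - intros [x [Ax Bx]]. exists x. now split.
Qed.

Lemma F_family_join_mem (I : Set) (q : I -> F X) (j : F X) :
  is_family_join (@F_le X) q j -> forall x, mem j x <-> exists i, mem (q i) x.
Proof.
  intros Hj x. split.
  - intros jx.
    assert (Hr : in_F (fun y => (exists i, mem (q i) y) \/ y <> x)).
    { apply in_F_list. exists (x :: nil). right. intros y Hy. right.
      intros ->. apply Hy. now left. }
    destruct (proj2 (Hj (exist _ _ Hr))) with x as [H | H]; auto.
    + intros i y qy. left. now exists i.
    + now destruct H.
  - intros [i qx]. exact (proj1 (Hj j) (fun _ H => H) i x qx).
Qed.

Lemma F_is_overlap : is_overlap (@F_le X) (@F_overlap X).
Proof.
  split.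
  - intros p q. rewrite !F_overlap_mem. intros [x []]. now exists x.
  - intros p q m Hm. rewrite !F_overlap_mem. intros [x [px qx]].
    exists x. split; [exact px |].
    (* [m] is an arbitrary meet, not necessarily [F_meet p q]; its universal property is tested on
       the singleton of [x]. *)
    apply F_singleton_le, Hm. now rewrite !F_singleton_le.
  - intros p I q j Hj. rewrite F_overlap_mem. split.
    + intros [x [px jx]]. apply (F_family_join_mem Hj) in jx as [i qx].
      exists i. apply F_overlap_mem. now exists x.
    + intros [i H]. apply F_overlap_mem in H as [x [px qx]].
      exists x. split; [exact px |]. apply (F_family_join_mem Hj). now exists i.
  - intros p q H x px.
    (* Density is only used for singletons: overlapping the singleton of [x] is containing [x]. *)
    destruct (proj1 (F_overlap_mem (F_singleton x) q)) as [y [-> qx]].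
    + apply H, F_overlap_mem. now exists x.
    + exact qx.
Qed.

Lemma F_set_based : set_based (@F_le X).
Proof.
  exists X, F_singleton. intros p r. split.
  - intros H [a Ha] x Hx. now apply H, Ha.
  - intros H x px. apply F_singleton_le.
    exact (H (exist _ x (proj2 (F_singleton_le x p) px))).
Qed.

Lemma F_bounded_lattice :
  is_bounded_lattice (@F_le X) F_meet F_join F_bot F_top.
Proof.
  split.
  - split.
    + intros p x px. exact px.
    + intros p q r Hpq Hqr x px. now apply Hqr, Hpq.
  - intros p q r. split.
    + intros H. split; intros x rx; now apply H.
    + intros [Hp Hq] x rx. split; [now apply Hp | now apply Hq].
  - intros p q r. split.
    + intros H. split; intros x Hx; apply H; [now left | now right].
    + intros [Hp Hq] x [px | qx]; [now apply Hp | now apply Hq].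
  - intros p x [].
  - intros p x _. exact I.
Qed.

Lemma F_imp_adjoint (p q r : F X) :
  F_le (F_meet p q) r <-> F_le p (F_imp q r).
Proof.
  split.
  - intros H x px qx. apply H. now split.
  - intros H x [px qx]. now apply (H x px).
Qed.

Lemma F_o_Heyting_algebra : is_o_Heyting_algebra (@F_le X) (@F_overlap X).
Proof.
  (* With the opposite taken as implication into bottom, the pseudo-complement law is an instance of
     the adjunction. *)
  exists F_meet, F_join, F_imp, F_bot, F_top, (fun p => F_imp p F_bot).
  split; [split |].
  - exact F_bounded_lattice.
  - intros p q. rewrite <- F_imp_adjoint. split.
    + now intros [H _].
    + intros H. split; [exact H | intros x []].
  - exact F_is_overlap.
  - exact F_set_based.
  - exact F_imp_adjoint.
Qed.

End F_Heyting.

(** * Excluded middle from a Boolean structure over one point *)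

Lemma Boolean_F_unit_excluded_middle :
  is_Boolean_algebra (@F_le unit) -> forall P : Prop, P \/ ~ P.
Proof.
  intros (meet & join & bot & top & compl & L & _ & C) P.
  assert (HP : in_F (fun _ : unit => P)).
  { apply in_F_list. exists (tt :: nil). left. intros [] _ H. apply H. now left. }
  set (A := exist _ _ HP : F unit).
  destruct (C A) as [[HM _] [_ HJ]].
  (* The given operations are abstract. Their universal properties place the abstract join below the
     pointwise one, and the pointwise top below the abstract top. *)
  assert (Htt : mem (F_join A (compl A)) tt).
  { apply (proj2 (lattice_join L A (compl A) (F_join A (compl A)))).
    - split; intros x Hx; [now left | now right].
    - apply HJ, (lattice_top L (F_top unit)). exact I. }
  destruct Htt as [p | c]; [now left | right]. intros p.
  (* Dually, the pointwise meet lies below the abstract meet, hence below the abstract bottom, hence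
     below the empty set. *)
  apply (lattice_bot L (F_bot unit) tt), HM.
  apply (proj2 (lattice_meet L A (compl A) (F_meet A (compl A)))).
  - split; now intros x [].
  - split; [exact p | exact c].
Qed.

(** * Incompleteness over the natural numbers *)

Lemma list_nat_bound (l : list nat) : exists m, forall x, List.In x l -> x < m.
Proof.
  exists (S (list_max l)). intros x Hx. apply Nat.lt_succ_r.
  revert x Hx. apply Forall_forall, list_max_le, le_n.
Qed.

Lemma F_nat_not_complete :
  ~ exists j, is_family_join (@F_le nat) (fun n => F_singleton (2 * n)) j.
Proof.
  intros [j Hj].
  assert (E : forall x, mem j x <-> exists n, x = 2 * n).
  { exact (F_family_join_mem Hj). }
  destruct (proj1 (in_F_list _) (proj2_sig j)) as [l H].
  destruct (list_nat_bound l) as [m Hm].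
  (* Both [2 * m] and [2 * m + 1] exceed every entry of [l]. The even one refutes boundedness, the
     odd one coboundedness. *)
  destruct H as [H | H].
  - apply (H (2 * m)).
    + apply E. now exists m.
    + intros Hl. apply Hm in Hl. lia.
  - destruct (proj1 (E (2 * m + 1))) as [n Hn]; [| lia].
    apply H. intros Hl. apply Hm in Hl. lia.
Qed.

(** * Kripke models of intuitionistic higher-order logic *)

Section Kripke.
Variables (W : Type) (acc : W -> W -> Prop).
Hypothesis acc_refl : forall w, acc w w.
Hypothesis acc_trans : forall u v w, acc u v -> acc v w -> acc u w.
Variable B : Type.

(** All elements exist at every world, but they may become equal later on. *)
Record wset : Type := {
  car :> Type;
  eqw : W -> car -> car -> Prop;
  eqw_mono : forall w w' x y, acc w w' -> eqw w x y -> eqw w' x y;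
  eqw_refl : forall w x, eqw w x x;
  eqw_sym : forall w x y, eqw w x y -> eqw w y x;
  eqw_trans : forall w x y z, eqw w x y -> eqw w y z -> eqw w x z }.

Record wpred (S : wset) : Type := {
  holds : W -> S -> Prop;
  holds_mono : forall w w' x, acc w w' -> holds w x -> holds w' x;
  holds_ext : forall w x y, eqw w x y -> holds w x -> holds w y }.

Definition discrete (T : Type) : wset.
Proof.
  refine {| car := T; eqw := fun _ x y => x = y |}; congruence.
Defined.

Definition wprod (S T : wset) : wset.
Proof.
  refine {| car := S * T;
            eqw := fun w x y => eqw w (fst x) (fst y) /\ eqw w (snd x) (snd y) |}.
  - intros w w' x y Hw []. split; eapply eqw_mono; eassumption.
  - intros w x. split; apply eqw_refl.
  - intros w x y []. split; now apply eqw_sym.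
  - intros w x y z [] []. split; eapply eqw_trans; eassumption.
Defined.

(** Equality quantifies over later worlds because agreement at one world need not persist. *)
Definition wpow (S : wset) : wset.
Proof.
  refine {| car := wpred S;
            eqw := fun w P Q => forall w', acc w w' ->
              forall x, holds P w' x <-> holds Q w' x |}.
  - intros w w' P Q Hw H w'' Hw'. apply H. eapply acc_trans; eassumption.
  - reflexivity.
  - intros w P Q H w' Hw x. symmetry. now apply H.
  - intros w P Q R H K w' Hw x. rewrite (H w' Hw x). now apply K.
Defined.

Fixpoint dom (s : sort) : wset :=
  match s with
  | base => discrete B
  | num => discrete nat
  | prd s t => wprod (dom s) (dom t)
  | pow s => wpow (dom s)
  end.

(** * Environments and forcing *)

Definition env (G : list sort) : Type := forall s, var G s -> dom s.

Definition env_nil : env nil :=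
  fun s v => match v in var E _ return match E with nil => dom s | _ => unit end with
             | vz => tt
             | vs _ => tt
             end.

Definition env_cons (G : list sort) (s : sort) (x : dom s) (e : env G) :
    env (s :: G) :=
  fun t v =>
    match v in var E t'
      return match E with
             | nil => unit
             | s' :: G' => dom s' -> env G' -> dom t'
             end
    with
    | vz => fun x _ => x
    | vs y => fun _ e => e _ y
    end x e.

(** Case analysis on a variable of a nonempty context. The return type is computed from the context,
    so no axiom on equality proofs is needed. *)
Lemma var_cons_ind (G : list sort) (s : sort) (P : forall t, var (s :: G) t -> Prop) :
  P s vz -> (forall t y, P t (vs y)) -> forall t v, P t v.
Proof.
  intros Hz Hs t v. revert P Hz Hs.
  refine (match v as v' in var E t'
    return match E return var E t' -> Prop with
           | nil => fun _ => True
           | s' :: G' => fun v' => forall P : forall t, var (s' :: G') t -> Prop,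
               P s' vz -> (forall t y, P t (vs y)) -> P t' v'
           end v' with
    | vz => _
    | vs y => _
    end); auto.
Qed.

Definition env_eqw (G : list sort) (w : W) (e e' : env G) : Prop :=
  forall s (v : var G s), eqw w (e s v) (e' s v).

Lemma env_eqw_cons (G : list sort) (s : sort) (x : dom s) (w : W) (e e' : env G) :
  env_eqw w e e' -> env_eqw w (env_cons x e) (env_cons x e').
Proof.
  intros H t v. revert t v. apply var_cons_ind.
  - apply eqw_refl.
  - exact H.
Qed.

Lemma env_eqw_cons_l (G : list sort) (s : sort) (x y : dom s) (w : W) (e : env G) :
  eqw w x y -> env_eqw w (env_cons x e) (env_cons y e).
Proof.
  intros H t v. revert t v. apply var_cons_ind.
  - exact H.
  - intros t v. apply eqw_refl.
Qed.

(** Carriers do not vary with the world, so [All] can stay at the current world; only [Imp] looks at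
    later ones. *)
Fixpoint force (G : list sort) (p : fm G) : W -> env G -> Prop :=
  match p in fm G return W -> env G -> Prop with
  | @Mem _ s x A => fun w e => @holds (dom s) (e _ A) w (e _ x)
  | @Pair _ s t x y z => fun w e => @eqw (dom (prd s t)) w (e _ x, e _ y) (e _ z)
  | Zero n => fun w e => e _ n = 0
  | Succ n m => fun w e => e _ m = S (e _ n)
  | Bot => fun _ _ => False
  | And p q => fun w e => force p w e /\ force q w e
  | Or p q => fun w e => force p w e \/ force q w e
  | Imp p q => fun w e => forall w', acc w w' -> force p w' e -> force q w' e
  | All s p => fun w e => forall x : dom s, force p w (env_cons x e)
  | Ex s p => fun w e => exists x : dom s, force p w (env_cons x e)
  end.

Lemma force_mono (G : list sort) (p : fm G) w w' (e : env G) :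
  acc w w' -> force p w e -> force p w' e.
Proof.
  intros Hw.
  induction p; cbn.
  - apply holds_mono, Hw.
  - intros [H1 H2]. split; eapply eqw_mono; eassumption.
  - auto.
  - auto.
  - auto.
  - intros []. auto.
  - intros []; auto.
  - intros H w'' Hw'. apply H. eapply acc_trans; eassumption.
  - intros H x. apply IHp, H.
  - intros [x H]. exists x. apply IHp, H.
Qed.

Lemma force_ext (G : list sort) (p : fm G) w (e e' : env G) :
  env_eqw w e e' -> force p w e -> force p w e'.
Proof.
  revert w e e'.
  induction p; cbn; intros w e e' He.
  - intros H. apply (He _ A) with (1 := acc_refl w).
    apply holds_ext with (1 := He _ x), H.
  - intros H.
    assert (Hz := He _ z). assert (Hx := He _ x). assert (Hy := He _ y).
    cbn in Hz. destruct H, Hz.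
    split; eauto using eqw_trans, eqw_sym.
  - now rewrite <- (He _ n : e _ n = e' _ n).
  - now rewrite <- (He _ n : e _ n = e' _ n), <- (He _ m : e _ m = e' _ m).
  - auto.
  - intros []. split; [eapply IHp1 | eapply IHp2]; eassumption.
  - intros []; [left; eapply IHp1 | right; eapply IHp2]; eassumption.
  - intros H w' Hw Hp.
    (* Equality of environments persists to [w']; the premise is carried back along its symmetric
       form. *)
    assert (He' : env_eqw w' e e') by (intros s v; now apply (eqw_mono Hw)).
    apply (IHp2 w' e e' He'), H; [exact Hw |].
    apply (IHp1 w' e' e); [| exact Hp]. intros s v. apply eqw_sym, He'.
  - intros H x. eapply IHp; [apply env_eqw_cons, He | apply H].
  - intros [x H]. exists x. eapply IHp; [apply env_eqw_cons, He | apply H].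
Qed.

(** Environments are functions; this replaces functional extensionality. *)
Lemma force_env_eq (G : list sort) (p : fm G) w (e e' : env G) :
  (forall s (v : var G s), e s v = e' s v) -> (force p w e <-> force p w e').
Proof.
  intros H. split; apply force_ext; intros s v; rewrite H; apply eqw_refl.
Qed.

Lemma force_rename (G : list sort) (p : fm G) (D : list sort) (r : ren G D) w
    (e : env D) :
  force (rename p r) w e <-> force p w (fun s v => e s (r s v)).
Proof.
  revert D r w e.
  assert (up_env : forall G D s (x : dom s) (r : ren G D) (e : env D) t
      (v : var (s :: G) t),
      env_cons x e (up r v) = env_cons x (fun s v => e s (r s v)) v).
  { intros G' D s x r e. now apply var_cons_ind. }
  induction p; cbn; intros D r w e; try reflexivity.
  - now rewrite IHp1, IHp2.
  - now rewrite IHp1, IHp2.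
  - split; intros H w' Hw Hp; apply IHp2, H, IHp1, Hp; exact Hw.
  - split; intros H x; specialize (H x).
    + apply IHp in H. revert H. apply force_env_eq. intros; now rewrite up_env.
    + apply IHp. revert H. apply force_env_eq. intros; now rewrite up_env.
  - split; intros [x H]; exists x.
    + apply IHp in H. revert H. apply force_env_eq. intros; now rewrite up_env.
    + apply IHp. revert H. apply force_env_eq. intros; now rewrite up_env.
Qed.

Lemma force_weaken (G : list sort) (s : sort) (p : fm G) w (x : dom s) (e : env G) :
  force (weaken s p) w (env_cons x e) <-> force p w e.
Proof. exact (force_rename p (@ren_shift G s) w (env_cons x e)). Qed.

Lemma force_inst (G : list sort) (s : sort) (p : fm (s :: G)) (x : var G s) w
    (e : env G) :
  force (inst p x) w e <-> force p w (env_cons (e s x) e).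
Proof.
  unfold inst. rewrite force_rename. apply force_env_eq. now apply var_cons_ind.
Qed.

(** * Soundness of the derivation system *)

Definition wpred_eqw (S : wset) (x : S) : wpred S.
Proof.
  refine {| holds := fun w y => eqw w x y |}.
  - intros w w' y. apply eqw_mono.
  - intros w y z Hyz Hxy. eapply eqw_trans; eassumption.
Defined.

(** The witness for comprehension; [force_mono] and [force_ext] make it a legitimate element of the
    power sort. *)
Definition wpred_force (G : list sort) (s : sort) (p : fm (s :: G)) (e : env G) :
    wpred (dom s).
Proof.
  refine {| holds := fun w x => force p w (env_cons x e) |}.
  - intros w w' x. apply force_mono.
  - intros w x y H. apply force_ext, env_eqw_cons_l, H.
Defined.

(** One direction tests Leibniz equality on the predicate of being equal to [x]; the other holds
    because predicates respect [eqw]. *)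
Lemma force_Eq (G : list sort) (s : sort) (x y : var G s) w (e : env G) :
  force (Eq x y) w e <-> eqw w (e s x) (e s y).
Proof.
  split.
  - intros H. apply (H (wpred_eqw (e s x)) w (acc_refl w)). apply eqw_refl.
  - intros H P w' Hw. apply holds_ext. exact (eqw_mono Hw H).
Qed.

Lemma force_axiom (G : list sort) (p : fm G) : axiom p -> forall w e, force p w e.
Proof.
  intros [] w e; cbn -[Eq rename up]; intros.
  - exists (wpred_force p0 e). intros x.
    enough (E : forall w', force (rename p0 (up (@ren_shift G (pow s)))) w'
        (env_cons x (env_cons (wpred_force p0 e : dom (pow s)) e)) <->
        force p0 w' (env_cons x e)) by (split; intros w' _; apply E).
    intros w'. rewrite force_rename. apply force_env_eq. now apply var_cons_ind.
  - apply force_Eq. intros w'' Hw x1.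
    destruct (H0 x1) as [H1 H2].
    split; [apply H1 | apply H2]; exact Hw.
  - exists (x, x0). split; apply eqw_refl.
  - apply force_Eq. cbn. destruct H0, H2.
    split; eauto using eqw_trans, eqw_sym, eqw_mono.
  - exists (fst x), (snd x). split; apply eqw_refl.
  - rewrite !force_Eq. cbn. destruct H0, H2.
    split; eauto using eqw_trans, eqw_sym, eqw_mono.
  - now exists 0.
  - apply force_Eq. cbn in *. congruence.
  - now exists (S x).
  - apply force_Eq. cbn in *. congruence.
  - apply force_Eq. cbn in *. congruence.
  - congruence.
  (* The numbers of the model are those of the metatheory, so ordinary induction applies. *)
  - induction x0 as [| n IH].
    + exact (holds_mono H1 (H0 0 w' (acc_refl w') eq_refl)).
    + exact (H2 n (S n) w'0 (acc_refl _) IH w'0 (acc_refl _) eq_refl).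
Qed.

Lemma force_sound (G : list sort) (H : list (fm G)) (p : fm G) :
  derivable H p ->
  forall w e, (forall q, List.In q H -> force q w e) -> force p w e.
Proof.
  induction 1 as
    [G H p Hp | G H p Hp | G H p _ IH | G H p q _ IHp _ IHq | G H p q _ IH
    | G H p q _ IH | G H p q _ IH | G H p q _ IH | G H p q r _ IH _ IHp _ IHq
    | G H p q _ IH | G H p q _ IHpq _ IHp | G H s p _ IH | G H s p x _ IH
    | G H s p x _ IH | G H s p q _ IHp _ IHq ];
    intros w e He.
  - now apply force_axiom.
  - now apply He.
  - destruct (IH w e He).
  - split; auto.
  - now apply (IH w e He).
  - now apply (IH w e He).
  - left. auto.
  - right. auto.
  - destruct (IH w e He); [apply IHp | apply IHq]; intros ? [<- |]; auto.
  - intros w' Hw Hp. apply IH. intros ? [<- | Hq]; [exact Hp |].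
    apply (force_mono Hw). auto.
  - exact (IHpq w e He w (acc_refl w) (IHp w e He)).
  - intros x. apply IH. intros q Hq. apply in_map_iff in Hq as [r [<- Hr]].
    apply force_weaken. auto.
  - apply force_inst, (IH w e He).
  - exists (e s x). apply force_inst. auto.
  - destruct (IHp w e He) as [x Hx].
    apply (force_weaken q w x e), IHq. intros ? [<- | Hr]; [exact Hx |].
    apply in_map_iff in Hr as [r [<- Hr]]. apply force_weaken. auto.
Qed.

End Kripke.

(** * Two worlds and one point *)

Definition bacc (w w' : bool) : Prop := w = true -> w' = true.

Lemma bacc_refl (w : bool) : bacc w w.
Proof. exact (fun H => H). Qed.
Arguments bacc_refl : clear implicits.

Lemma bacc_trans (u v w : bool) : bacc u v -> bacc v w -> bacc u w.
Proof. exact (fun H K x => K (H x)). Qed.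

Local Notation dom2 := (dom bacc_trans unit).
Local Notation subset2 := (car (dom2 (pow base))).
Local Notation env2 := (env bacc_trans unit).
Local Notation force2 := (@force bool bacc bacc_trans unit _).

(** Over a single point, a subset amounts to an upward closed set of worlds, that is, a truth value
    of the model. *)
Definition subset2_of (V : bool -> Prop)
    (V_mono : forall w w', bacc w w' -> V w -> V w') : subset2.
Proof.
  refine {| holds := fun w (_ : dom2 base) => V w |}.
  - intros w w' _. apply V_mono.
  - auto.
Defined.

Definition empty2 : subset2 := @subset2_of (fun _ => False) (fun _ _ _ H => H).
Definition full2 : subset2 := @subset2_of (fun _ => True) (fun _ _ _ H => H).
Definition half2 : subset2 := @subset2_of (fun w => w = true) (fun _ _ H => H).

Definition inter2 (P Q : subset2) : subset2.
Proof.
  refine (@subset2_of (fun w => holds P w tt /\ holds Q w tt) _).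
  intros w w' Hw []. split; now apply (holds_mono Hw).
Defined.

Definition union2 (P Q : subset2) : subset2.
Proof.
  refine (@subset2_of (fun w => holds P w tt \/ holds Q w tt) _).
  intros w w' Hw []; [left | right]; now apply (holds_mono Hw).
Defined.

Lemma force_Finite_full2 (G : list sort) (K : var G (pow base)) w (e : env2 G) :
  e _ K = full2 -> force2 (Finite K) w e.
Proof.
  intros EK Phi w1 _ Hempty w2 H12 Hadd. cbn. rewrite EK.
  (* The full subset arises from the empty one by adding the only point. *)
  refine (Hadd empty2 tt full2 w2 (bacc_refl _) _ w2 (bacc_refl _) _).
  - apply (holds_mono H12). apply (Hempty empty2 w1 (bacc_refl _)).
    intros x w' _ [].
  - intros [].
    split; intros w3 _ _; [right | exact I].
    apply force_Eq; [exact bacc_refl | reflexivity].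
Qed.

(** Every subset is bounded by the finite set [full2]. Hence the quantifiers restricted to [In_F]
    range over all subsets. *)
Lemma force_In_F (G : list sort) (A : var G (pow base)) w e : force2 (In_F A) w e.
Proof.
  exists full2. split.
  - now apply force_Finite_full2.
  - left. intros x w1 _ _ w2 _ H. exact (H w2 (bacc_refl _) I).
Qed.

Lemma force_Le (G : list sort) (P Q : var G (pow base)) w (e : env2 G) :
  force2 (Le P Q) w e <->
  forall w', bacc w w' -> holds (e _ P) w' tt -> holds (e _ Q) w' tt.
Proof.
  split.
  - intros H. exact (H tt).
  - intros H []. exact H.
Qed.

Lemma force_AllF (G : list sort) (p : fm (pow base :: G)) w (e : env2 G) :
  force2 (AllF p) w e -> forall P : subset2, force2 p w (env_cons P e).
Proof. intros H P. apply (H P w (bacc_refl _)), force_In_F. Qed.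

Lemma force_ExF (G : list sort) (p : fm (pow base :: G)) w (e : env2 G) :
  force2 (ExF p) w e -> exists P : subset2, force2 p w (env_cons P e).
Proof. intros [P [_ H]]. now exists P. Qed.

Lemma force_Is_meet (G : list sort) (P Q M : var G (pow base)) w (e : env2 G) :
  e _ M = inter2 (e _ P) (e _ Q) -> force2 (Is_meet P Q M) w e.
Proof.
  intros EM R w1 _ _. split; intros w2 _ H.
  - split; apply force_Le; intros w3 H23 HR;
      pose proof (proj1 (force_Le _ _ _ _) H w3 H23 HR) as HM;
      cbn in HM; rewrite EM in HM; apply HM.
  - destruct H as [HP HQ]. apply force_Le. intros w3 H23 HR. cbn. rewrite EM.
    split; [exact (proj1 (force_Le _ _ _ _) HP w3 H23 HR)
           | exact (proj1 (force_Le _ _ _ _) HQ w3 H23 HR)].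
Qed.

Lemma force_Is_join (G : list sort) (P Q J : var G (pow base)) w (e : env2 G) :
  e _ J = union2 (e _ P) (e _ Q) -> force2 (Is_join P Q J) w e.
Proof.
  intros EJ R w1 _ _. split; intros w2 _ H.
  - split; apply force_Le; intros w3 H23 HR;
      apply (proj1 (force_Le _ _ _ _) H w3 H23); cbn; rewrite EJ;
      [left | right]; exact HR.
  - destruct H as [HP HQ]. apply force_Le. intros w3 H23 HJ.
    cbn in HJ. rewrite EJ in HJ. destruct HJ as [HJ | HJ].
    + exact (proj1 (force_Le _ _ _ _) HP w3 H23 HJ).
    + exact (proj1 (force_Le _ _ _ _) HQ w3 H23 HJ).
Qed.

Lemma not_force_Complemented :
  ~ force2 Complemented false (@env_nil bool bacc bacc_trans unit).
Proof.
  intros H.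
  (* [C] is the supposed complement of [half2], at the world [false]. *)
  destruct (force_ExF (force_AllF H half2)) as [C [HM HJ]].
  assert (Hbot := force_AllF HM (inter2 half2 C) false (bacc_refl _)).
  assert (Htop := force_AllF HJ (union2 half2 C) false (bacc_refl _)).
  specialize (Hbot ltac:(now apply force_Is_meet)).
  specialize (Htop ltac:(now apply force_Is_join)).
  apply force_AllF with (P := empty2) in Hbot.
  apply force_AllF with (P := full2) in Htop.
  rewrite force_Le in Hbot, Htop.
  assert (Hft : bacc false true) by easy.
  (* At [false] the point is not in [half2], so it would be in [C]. It stays in [C] at [true], where
     it is also in [half2], against the emptiness of the intersection. *)
  destruct (Htop false (bacc_refl _) I) as [Hhalf | HC].
  - discriminate Hhalf.
  - apply (Hbot true Hft). split; [reflexivity | exact (holds_mono Hft HC)].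
Qed.

Theorem proposition4p18 :
  (forall X : Set, is_o_Heyting_algebra (@F_le X) (@F_overlap X)) /\
  (((forall X : Set, is_Boolean_algebra (@F_le X)) -> forall P : Prop, P \/ ~ P) /\
   ~ derivable nil Boolean_algebra_F) /\
  ~ (forall X : Set, is_o_algebra (@F_le X) (@F_overlap X)).
Proof.
  split; [exact F_o_Heyting_algebra |].
  split; [split |].
  - intros H. exact (Boolean_F_unit_excluded_middle (H unit)).
  - intros H. apply not_force_Complemented.
    (* [Complemented] is the last conjunct of the formula that soundness makes true at [false]. *)
    apply (force_sound (acc_trans := bacc_trans) (B := unit) bacc_refl H (w := false)).
    intros q [].
  - intros H. apply F_nat_not_complete. exact (o_algebra_joins (H nat) _).
Qed.
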